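(* Let $K$ be a compact Hausdorff space and let $H$ be a complex Hilbert space. Suppose $x_0\in S(H)$ and $\mathcal{O}\neq \emptyset$ is an open subset of $K$. Let $p= \chi_{\mathcal{O}}$, let $$N= \{ a\in C(K,H) : ap= \mu\, x_0 \otimes p \text{ for some } \mu\in \mathbb{C} \},$$ and let $\varphi: N\to \mathbb{C}$ be the triple homomorphism defined by $\varphi(a) = \langle a(t_0) | x_0\rangle$ ($a\in N$), where $t_0$ is any element in $\mathcal{O}$. Then the closed unit ball of $N_{\mathbb{R}}^\varphi:= \varphi^{-1}(\mathbb{R})$ coincides with the closed convex hull of its extreme points. Consequently, $\mathcal{B}_{N_{\mathbb{R}}^\varphi}$ satisfies the strong Mankiewicz property.
   Context: $C(K,H)$ is the Banach space of all continuous functions from $K$ to $H$, with the supremum norm; it is a JB$^*$-triple with product $\{a,b,c\}=\frac12\langle a|b\rangle c+\frac12\langle c|b\rangle a$, where $\langle a|b\rangle(t)=\langle a(t)|b(t)\rangle$. $S(X)$ and $\mathcal{B}_X$ are the unit sphere and closed unit ball of a normed space $X$. $\chi_{\mathcal{O}}$ is the characteristic function of $\mathcal{O}$ (not necessarily continuous); $ap$ is the pointwise product $t\mapsto p(t)a(t)$ and $x_0\otimes p$ is the map $t\mapsto p(t)x_0$. Thus $N$ consists of the $a\in C(K,H)$ that are constantly equal to some $\mu x_0$ on $\mathcal{O}$, and $\varphi(a)$ is that $\mu$. A triple homomorphism is a linear map preserving triple products. A convex subset $\mathcal{K}$ of a normed space $X$ satisfies the strong Mankiewicz property if every surjective isometry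 from $\mathcal{K}$ onto an arbitrary convex subset $L$ of a normed space $Y$ is affine. *)

(* Defs.v *)
From HB Require Import structures.
From mathcomp Require Import all_boot all_order all_algebra.
From mathcomp Require Import all_classical all_reals all_analysis.
From mathcomp.real_closed Require Import complex.
From mathcomp Require Import ring.

Set Implicit Arguments.
Unset Strict Implicit.
Unset Printing Implicit Defensive.

Import Order.TTheory GRing.Theory Num.Theory ComplexField.
Import numFieldNormedType.Exports.

Local Open Scope classical_set_scope.
Local Open Scope complex_scope.
Local Open Scope ring_scope.

Section realification.
Context {R : realType}.

(* V with the scalars restricted to R and the same norm: norms over [R[i]] take
   values in [R[i]], hence the [Re]. *)
Definition realification (V : normedModType R[i]) : Type := V.

Context (V : normedModType R[i]).
Local Notation VR := (realification V).

HB.instance Definition _ := Choice.on VR.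
HB.instance Definition _ := GRing.Zmodule.on VR.

Let scale (r : R) (v : VR) : VR := (r%:C *: (v : V))%R.

Let scaleA a b v : scale a (scale b v) = scale (a * b) v.
Proof. by rewrite /scale scalerA rmorphM. Qed.

Let scale1 : left_id 1 scale.
Proof. by move=> v; rewrite /scale rmorph1 scale1r. Qed.

Let scaleDr : right_distributive scale +%R.
Proof. by move=> r u v; rewrite /scale scalerDr. Qed.

Let scaleDl v : {morph scale^~ v : a b / a + b}.
Proof. by move=> a b; rewrite /scale rmorphD scalerDl. Qed.

HB.instance Definition _ :=
  GRing.Zmodule_isLmodule.Build R VR scaleA scale1 scaleDr scaleDl.

Let rnorm (v : VR) : R := complex.Re `|(v : V)|.

Let rnormE v : (rnorm v)%:C = `|(v : V)|.
Proof. by apply: RRe_real; rewrite normr_real. Qed.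

Let rnormD u v : rnorm (u + v) <= rnorm u + rnorm v.
Proof. by rewrite -lecR rmorphD/= !rnormE; exact: (@ler_normD _ V). Qed.

Let rnormZ r v : rnorm (r *: v) = `|r| * rnorm v.
Proof.
apply: complexI; rewrite rmorphM/= !rnormE [LHS](@normrZ _ V); congr (_ * _).
by rewrite normc_def/= expr0n/= addr0 sqrtr_sqr.
Qed.

Let rnorm0_eq0 v : rnorm v = 0 -> v = 0.
Proof.
move=> /(congr1 (real_complex R)); rewrite rnormE => /eqP.
by rewrite normr_eq0 => /eqP.
Qed.

HB.instance Definition _ :=
  Lmodule_isNormed.Build R VR rnormD rnormZ rnorm0_eq0.

End realification.

Section continuous_functions.
Context {R : realType} {K : topologicalType}.

Definition continuous_pred (H : normedModType R[i]) : {pred K -> H} :=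
  [pred f | `[< continuous f >]].
Arguments continuous_pred : clear implicits.

(* C(K, H).  The compactness of K is an argument of the type because the
   supremum norm needs it. *)
Record contfun (cK : compact [set: K]) (H : normedModType R[i]) := ContFun {
  contfun_val :> K -> H ;
  _ : contfun_val \in continuous_pred H }.

Context (cK : compact [set: K]) (H : normedModType R[i]).
Local Notation C := (contfun cK H).

HB.instance Definition _ := [isSub for @contfun_val cK H].
HB.instance Definition _ := [Choice of C by <:].

Lemma contfun_continuous (f : C) : continuous f.
Proof. by case: f => f /= /asboolP. Qed.

Let continuous_pred_submod : submod_closed (continuous_pred H).
Proof.
split; first by apply/asboolP => t; exact: cvg_cst.
move=> a f g /asboolP cf /asboolP cg; apply/asboolP => t.
by apply: cvgD; [apply: cvgZr; exact: cf|exact: cg].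
Qed.
HB.instance Definition _ :=
  GRing.isSubmodClosed.Build _ _ (continuous_pred H) continuous_pred_submod.
HB.instance Definition _ := [SubChoice_isSubLmodule of C by <:].

Definition supnorm (f : C) : R := sup [set complex.Re `|f t| | t in [set: K]].

Let normRe (v : H) : (complex.Re `|v|)%:C = `|v|.
Proof. by apply: RRe_real; rewrite normr_real. Qed.

Lemma supnorm_has_ubound (f : C) :
  has_ubound [set complex.Re `|f t| | t in [set: K]].
Proof.
have cg : continuous (fun t => complex.Re `|f t|).
  move=> t; apply/cvgrPdist_lt => e e0.
  have e0C : 0 < e%:C by rewrite ltcR.
  have /cvgrPdist_lt /(_ _ e0C) := @contfun_continuous f t.
  apply: filterS => s /=; rewrite -ltcR; apply: le_lt_trans.
  have normE (x y : R) : (`|x - y|)%:C = `|x%:C - y%:C|.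
    by rewrite -rmorphB/= normc_def/= expr0n/= addr0 sqrtr_sqr.
  rewrite normE !normRe; exact: ler_dist_dist.
have : compact [set complex.Re `|f t| | t in [set: K]].
  by apply: continuous_compact cK; exact: continuous_subspaceT.
move=> /compact_bounded [M [_ /(_ (M + 1))]]; rewrite ltrDl ltr01.
move=> /(_ isT) hM.
by exists (M + 1) => x /hM; exact: le_trans (ler_norm _).
Qed.

Lemma le_supnorm (f : C) t : complex.Re `|f t| <= supnorm f.
Proof. by apply: ub_le_sup; [exact: supnorm_has_ubound|exists t]. Qed.
Let supnorm_le (f : C) (M : R) :
  0 <= M -> (forall t, complex.Re `|f t| <= M) -> supnorm f <= M.
Proof.
move=> M0 fM; rewrite /supnorm.
have [->|/set0P A0] := eqVneq [set complex.Re `|f t| | t in [set: K]] set0.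
  by rewrite sup0.
by apply: ge_sup => // _ [t _ <-].
Qed.

Lemma supnorm_ge0 (f : C) : 0 <= supnorm f.
Proof.
have [A0|/set0P[_ [t _ _]]] :=
  eqVneq [set complex.Re `|f t| | t in [set: K]] set0.
  by rewrite /supnorm A0 sup0.
by apply: le_trans (le_supnorm f t); rewrite -ler0c normRe.
Qed.

Let cnorm (f : C) : R[i] := (supnorm f)%:C.

Let cnormD f g : cnorm (f + g) <= cnorm f + cnorm g.
Proof.
rewrite /cnorm -rmorphD/= lecR; apply: supnorm_le => [|t].
  by rewrite addr_ge0// supnorm_ge0.
apply: le_trans (lerD (le_supnorm f t) (le_supnorm g t)).
by rewrite -lecR rmorphD/= !normRe; exact: ler_normD.
Qed.

Let cnormZ_le (a : R[i]) f : cnorm (a *: f) <= `|a| * cnorm f.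
Proof.
have aE : `|a| = (complex.Re `|a|)%:C by rewrite RRe_real ?normr_real.
rewrite /cnorm aE -rmorphM/= lecR; apply: supnorm_le => [|t].
  by rewrite mulr_ge0 ?supnorm_ge0// -ler0c -aE.
have -> : complex.Re `|(a *: f) t| = complex.Re `|a| * complex.Re `|f t|.
  by apply: complexI; rewrite rmorphM/= !normRe -aE; exact: normrZ.
by rewrite ler_wpM2l ?le_supnorm// -ler0c -aE.
Qed.

Let cnormZ (a : R[i]) f : cnorm (a *: f) = `|a| * cnorm f.
Proof.
apply/eqP; rewrite eq_le cnormZ_le/=.
have [->|a0] := eqVneq a 0.
  by rewrite normr0 mul0r /cnorm ler0c supnorm_ge0.
rewrite -{1}(scalerK a0 f) -ler_pdivlMl ?normr_gt0// -normfV.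
exact: cnormZ_le.
Qed.

Let cnorm0_eq0 f : cnorm f = 0 -> f = 0.
Proof.
move=> f0; apply/val_inj/funext => t /=.
apply/eqP; rewrite -normr_le0 -normRe -[leRHS]f0 lecR; exact: le_supnorm.
Qed.

HB.instance Definition _ :=
  Lmodule_isNormed.Build R[i] C cnormD cnormZ cnorm0_eq0.

End continuous_functions.
Arguments continuous_pred {R K} H _.

HB.mixin Record NormedModule_isHilbert (R : realType) H
    & CompleteNormedModule R[i] H := {
  inner : {dot H for Num.conj} ;
  innerE : forall x : H, inner x x = `|x| ^+ 2
}.

(* complex Hilbert spaces; [inner] is linear in its first argument *)
#[short(type="hilbertType")]
HB.structure Definition Hilbert (R : realType) :=
  {H of CompleteNormedModule R[i] H & NormedModule_isHilbert R H}.

Section inner_product.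
Context {R : realType} {H : hilbertType R}.
Implicit Types u v : H.

Lemma innerC u v : inner u v = (inner v u)^*%R.
Proof. by rewrite hermC expr0 mul1r. Qed.

Lemma innerDl u v w : inner (u + v) w = inner u w + inner v w.
Proof. exact: linearDl. Qed.

Lemma innerZl (a : R[i]) u v : inner (a *: u) v = a * inner u v.
Proof. exact: linearZl_LR. Qed.

Lemma innerDr u v w : inner u (v + w) = inner u v + inner u w.
Proof.
by rewrite [LHS]innerC innerDl rmorphD [inner u v]innerC [inner u w]innerC.
Qed.

Lemma innerZr (a : R[i]) u v : inner u (a *: v) = a^*%R * inner u v.
Proof. by rewrite [LHS]innerC innerZl rmorphM [inner u v]innerC. Qed.

Lemma normr_inner u v : `|inner u v| <= `|u| * `|v|.
Proof.
have [->|v0] := eqVneq v 0.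
  by rewrite innerC -(scale0r 0) innerZl mul0r rmorph0 normr0 mulr_ge0.
have nv0 : 0 < `|v| ^+ 2 by rewrite exprn_gt0 ?normr_gt0.
pose d := inner u v.
have dJ : inner v u = d^*%R by rewrite innerC.
have : 0 <= inner (`|v| ^+ 2 *: u + (- d) *: v) (`|v| ^+ 2 *: u + (- d) *: v).
  by rewrite innerE exprn_ge0.
have nJ : (`|v| ^+ 2)^*%R = `|v| ^+ 2.
  by rewrite conj_Creal// rpredX// normr_real.
rewrite !(innerDl, innerDr, innerZl, innerZr) dJ !innerE -/d rmorphN/= nJ.
set q := `|v| ^+ 2.
have -> : q * (q * `|u| ^+ 2) + q * (- d^* * d) +
    (- d * (q * d^*) + - d * (- d^* * q)) =
    q * (q * `|u| ^+ 2 - d * d^*) :> R[i] by ring.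
rewrite pmulr_rge0// subr_ge0 -normCK /q -exprMn mulrC.
by rewrite ler_pXn2r ?nnegrE ?mulr_ge0.
Qed.

Lemma continuous_inner (T : topologicalType) (f g : T -> H) :
  continuous f -> continuous g ->
  continuous (fun t => inner (f t) (g t) : R[i]^o).
Proof.
move=> cf cg s; apply/cvgrPdist_lt => e e0.
have f0 : `|f s - f t| * `|g t| + `|f s| * `|g s - g t| @[t --> s] -->
    (0 : R[i]^o).
  rewrite -[X in _ --> X](addr0 (0:R[i])) -{1}(mul0r `|g s|) -{2}(mulr0 `|f s|).
  apply: cvgD; apply: cvgM.
  - rewrite -(normr0 H) -(subrr (f s)); apply: cvg_norm.
    by apply: cvgB; [exact: cvg_cst|exact: cf].
  - by apply: cvg_norm; exact: cg.
  - exact: cvg_cst.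
  - rewrite -(normr0 H) -(subrr (g s)); apply: cvg_norm.
    by apply: cvgB; [exact: cvg_cst|exact: cg].
move/cvgr0_norm_lt : f0 => /(_ _ e0).
apply: filterS => t /=; apply: le_lt_trans.
rewrite [leRHS]ger0_norm ?addr_ge0 ?mulr_ge0//.
have -> : inner (f s) (g s) - inner (f t) (g t) =
    inner (f s + (-1) *: f t) (g t) + inner (f s) (g s + (-1) *: g t).
  by rewrite innerDl innerDr innerZl innerZr rmorphN1; ring.
rewrite !scaleN1r; apply: le_trans (ler_normD _ _) _.
by apply: lerD; exact: normr_inner.
Qed.

End inner_product.

Section triple.
Context {R : realType} {K : topologicalType} (cK : compact [set: K]).
Context (H : hilbertType R).
Local Notation C := (contfun cK H).

Let triple_fun (a b c : C) (t : K) : H :=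
  2^-1 *: (inner (a t) (b t) *: c t) + 2^-1 *: (inner (c t) (b t) *: a t).

Let triple_continuous a b c : triple_fun a b c \in continuous_pred H.
Proof.
have cont (f g h : C) : continuous (fun t => inner (f t) (g t) *: h t).
  move=> t; apply: (@cvgZ R[i] H); last exact: contfun_continuous.
  by apply: continuous_inner; exact: contfun_continuous.
apply/asboolP => t; apply: cvgD; apply: cvgZr; exact: cont.
Qed.

Definition triple (a b c : C) : C := ContFun cK (triple_continuous a b c).

Definition Nset (x0 : H) (O : set K) : set C :=
  [set a | exists mu : R[i],
    (fun t => \1_O t *: a t) = (fun t => mu *: (\1_O t *: x0))].

Definition phi (x0 : H) (t0 : K) (a : C) : R[i] := inner (a t0) x0.

Definition Nset_real (x0 : H) (O : set K) (t0 : K) : set (realification C) :=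
  [set a | Nset x0 O a /\ phi x0 t0 a \is Num.real].

Section Nset_theory.
Context (x0 : H) (O : set K) (t0 : K).
Context (x01 : `|x0| = 1) (Ot0 : O t0).

Lemma NsetP (a : C) :
  Nset x0 O a <-> exists mu, forall t, O t -> a t = mu *: x0.
Proof.
split=> [[mu aE]|[mu aE]]; exists mu.
  move=> t Ot; have /= := congr1 (@^~ t) aE.
  by rewrite indicE mem_set// !scale1r.
apply/funext => t; rewrite indicE.
have [/set_mem/aE ->|_] := boolP (t \in O); first by rewrite !scale1r.
by rewrite !scale0r scaler0.
Qed.

Lemma phiE (a : C) mu : (forall t, O t -> a t = mu *: x0) -> phi x0 t0 a = mu.
Proof.
by move=> aE; rewrite /phi aE// innerZl innerE x01 expr1n mulr1.
Qed.

Lemma Nset_phiE (a : C) t : Nset x0 O a -> O t -> a t = phi x0 t0 a *: x0.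
Proof. by move=> /NsetP[mu aE] Ot; rewrite (phiE aE) aE. Qed.

Lemma phi_indep (a : C) t : Nset x0 O a -> O t -> phi x0 t a = phi x0 t0 a.
Proof.
by move=> Na Ot; rewrite /phi (Nset_phiE Na Ot) innerZl innerE x01 expr1n mulr1.
Qed.

Lemma Nset_linear (k : R[i]) (a b : C) :
  Nset x0 O a -> Nset x0 O b -> Nset x0 O (k *: a + b).
Proof.
move=> Na Nb; apply/NsetP; exists (k * phi x0 t0 a + phi x0 t0 b) => t Ot.
have -> : (k *: a + b) t = k *: a t + b t by [].
by rewrite !(Nset_phiE _ Ot)// scalerA scalerDl.
Qed.

Lemma phi_linear (k : R[i]) (a b : C) :
  phi x0 t0 (k *: a + b) = k * phi x0 t0 a + phi x0 t0 b.
Proof.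
rewrite /phi; have -> : (k *: a + b) t0 = k *: a t0 + b t0 by [].
by rewrite innerDl innerZl.
Qed.

Let tripleE (a b c : C) t : Nset x0 O a -> Nset x0 O b -> Nset x0 O c -> O t ->
  triple a b c t = (phi x0 t0 a * (phi x0 t0 b)^*%R * phi x0 t0 c) *: x0.
Proof.
move=> Na Nb Nc Ot; rewrite /= /triple_fun !(Nset_phiE _ Ot)//.
rewrite !innerZl !innerZr innerE x01 expr1n mulr1 !scalerA -scalerDl.
by congr (_ *: _); field.
Qed.

(* The next two lemmas say that Nset is a subtriple of C(K, H) and that phi
   preserves triple products: on the scalars {a, b, c} = a * b^* * c. *)
Lemma Nset_triple (a b c : C) :
  Nset x0 O a -> Nset x0 O b -> Nset x0 O c -> Nset x0 O (triple a b c).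
Proof.
by move=> Na Nb Nc; apply/NsetP; eexists => t Ot; exact: tripleE.
Qed.

Lemma phi_triple (a b c : C) : Nset x0 O a -> Nset x0 O b -> Nset x0 O c ->
  phi x0 t0 (triple a b c) = phi x0 t0 a * (phi x0 t0 b)^*%R * phi x0 t0 c.
Proof. by move=> Na Nb Nc; apply: phiE => t Ot; exact: tripleE. Qed.

End Nset_theory.
End triple.

Lemma norm_realification_contfun (R : realType) (K : topologicalType)
  (cK : compact [set: K]) (H : normedModType R[i]) (a : contfun cK H) :
  `|(a : realification (contfun cK H))| = supnorm a.
Proof. by []. Qed.

Section convexity.
Context {R : realType} {X : normedModType R}.

Definition extreme_points (A : set X) : set X :=
  [set x | A x /\ forall y z (t : R), A y -> A z -> 0 < t < 1 ->
    x = t *: y + (1 - t) *: z -> y = x /\ z = x].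

Definition closed_convex_hull (A : set X) : set X :=
  closure (smallest (@convex_set R X) A).

Definition unit_ball (A : set X) : set X := [set x | A x /\ `|x| <= 1].

Definition strong_mankiewicz (A : set X) : Prop :=
  convex_set A /\
  forall (Y : normedModType R) (L : set Y) (f : X -> Y),
    convex_set L -> f @` A = L ->
    (forall x y, A x -> A y -> `|f x - f y| = `|x - y|) ->
    forall x y (t : R), A x -> A y -> 0 <= t <= 1 ->
      f (t *: x + (1 - t) *: y) = t *: f x + (1 - t) *: f y.

End convexity.

(* Main.v *)
(* Mankiewicz property.  Let [B] be a unit ball which is the closed convex hull
   of its extreme points, and [f] an isometry of [B] onto a convex set.  If [e]
   is extreme, [m] is the only point at distance at most [r] from both [m - r e]
   and [m + r e]; as midpoints of the image lie in the image, [f] preserves the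
   midpoints of segments parallel to [e].  Applied to the diagonal of a rectangle
   with sides parallel to extreme points [e] and [e'], the same uniqueness shows
   that [f (x + s e + t e') + f x = f (x + s e) + f (x + t e')].  This relation is
   symmetric in [e] and [e'], and convex and closed in each of them, so it holds
   for all vectors of [B], whence [f] is affine.

   Density of the convex hull.  By strict convexity of [H], the elements of
   [N_R^phi] of constant norm 1 are extreme in [B].  An element of [B] is a
   convex combination of two elements equal to [x0] and [- x0] on [O].  If [b] is
   a constant of norm 1 on [O], it is a limit of functions [a] admitting a
   function [u] of constant norm 1 which agrees with [a] wherever [|a| = 1].  For
   such a pair, [a + u] is again a sum of two functions of this kind, as in the
   Russo-Dye theorem, so [(n a + u) / (n + 1)] is in their convex hull for all
   [n]. *)
Require Import Defs.
From mathcomp Require Import all_boot all_order all_algebra.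
From mathcomp Require Import all_classical all_reals all_analysis.
From mathcomp.real_closed Require Import complex.
From mathcomp Require Import ring lra.

Set Implicit Arguments.
Unset Strict Implicit.
Unset Printing Implicit Defensive.

Import Order.TTheory GRing.Theory Num.Theory ComplexField.
Import numFieldNormedType.Exports.

Local Open Scope classical_set_scope.
Local Open Scope ring_scope.

(** * Linear identities *)

Inductive lexp (R : Type) : Type :=
  | LVar of nat
  | LZero
  | LOpp of lexp R
  | LAdd of lexp R & lexp R
  | LScale of R & lexp R.
Arguments LVar {R}.
Arguments LZero {R}.
Arguments LOpp {R}.
Arguments LAdd {R}.
Arguments LScale {R}.

Section lexp.
Context {R : nzRingType} {V : lmodType R}.

Fixpoint leval (s : seq V) (e : lexp R) : V :=
  match e with
  | LVar i => s`_i
  | LZero => 0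
  | LOpp e => - leval s e
  | LAdd e1 e2 => leval s e1 + leval s e2
  | LScale a e => a *: leval s e
  end.

Fixpoint lcoef (e : lexp R) (i : nat) : R :=
  match e with
  | LVar j => if i == j then 1 else 0
  | LZero => 0
  | LOpp e => - lcoef e i
  | LAdd e1 e2 => lcoef e1 i + lcoef e2 i
  | LScale a e => a * lcoef e i
  end.

(** Recursion on [n] instead of a quantifier, so that simplification leaves one scalar equation per
    listed vector. *)
Fixpoint same_lcoef (n : nat) (e1 e2 : lexp R) : Prop :=
  if n is m.+1 then lcoef e1 m = lcoef e2 m /\ same_lcoef m e1 e2 else True.

Lemma leval_sum (s : seq V) (e : lexp R) :
  leval s e = \sum_(i < size s) lcoef e i *: s`_i.
Proof.
elim: e => [j||e IH|e1 IH1 e2 IH2|a e IH] /=.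
- have [js|sj] := ltnP j (size s); last first.
    rewrite nth_default// big1// => i _.
    by case: eqP (ltn_ord i) => [->|_ _]; rewrite ?ltnNge ?sj ?scale0r.
  rewrite (bigD1 (Ordinal js))//= eqxx// scale1r big1 ?addr0// => i ij.
  by case: eqP => [e|]; rewrite ?scale0r//; case/eqP: ij; exact: val_inj.
- by rewrite big1// => i _; rewrite scale0r.
- by rewrite IH -sumrN; apply: eq_bigr => i _; rewrite scaleNr.
- by rewrite IH1 IH2 -big_split; apply: eq_bigr => i _; rewrite scalerDl.
- by rewrite IH scaler_sumr; apply: eq_bigr => i _; rewrite scalerA.
Qed.

Lemma leval_eq (s : seq V) (e1 e2 : lexp R) :
  same_lcoef (size s) e1 e2 -> leval s e1 = leval s e2.
Proof.
move=> h; rewrite !leval_sum; apply: eq_bigr => i _.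
suff -> : lcoef e1 i = lcoef e2 i by [].
move: (size s) h i; elim=> [_ [] //|n IH [en h] i].
by have := ltn_ord i; rewrite ltnS leq_eqVlt => /predU1P[->//|lin];
  exact: (IH h (Ordinal lin)).
Qed.

End lexp.

Ltac lindex v s :=
  match s with
  | ?w :: _ =>
    let _ := match goal with _ => unify v w end in constr:(0%N)
  | _ :: ?s' => let n := lindex v s' in constr:(n.+1)
  end.

Ltac lreify R s t :=
  lazymatch t with
  | 0 => constr:(@LZero R)
  | - ?a => let a' := lreify R s a in constr:(@LOpp R a')
  | ?a + ?b => let a' := lreify R s a in let b' := lreify R s b in
      constr:(@LAdd R a' b')
  | ?c *: ?a => let a' := lreify R s a in constr:(@LScale R c a')
  | ?v => let i := lindex v s in constr:(@LVar R i)
  end.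

(* Proves a linear identity between the vectors listed in [s] by comparing the
   coefficients of both sides. *)
Ltac lmod R s :=
  lazymatch goal with
  | |- @eq ?V ?a ?b =>
    let a' := lreify R s a in let b' := lreify R s b in
    refine (@leval_eq _ _ s a' b' _);
    rewrite /=; repeat split; try (field; try done)
  end.

(** * Convex hulls *)

Section closed_convex_hull.
Context {R : realType} {X : normedModType R}.
Implicit Types A E W : set X.

Lemma convex_setP A :
  convex_set A <-> forall x y (t : R), 0 <= t <= 1 -> A x -> A y ->
    A (t *: x + (1 - t) *: y).
Proof.
split=> [cA x y t /andP[t0 t1] Ax Ay|cA x y t].
  by have /set_mem := cA x y (Itv01 t0 t1) (mem_set Ax) (mem_set Ay).
move=> /set_mem Ax /set_mem Ay; apply/mem_set; apply: cA => //.
by rewrite ge0 le1.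
Qed.

Lemma closureP A x :
  closure A x <-> forall e : R, 0 < e -> exists2 y, A y & `|x - y| < e.
Proof.
split=> [Ax e e0|h B].
  have [y [Ay xy]] := Ax _ (nbhsx_ballx x e e0).
  by exists y => //; rewrite -ball_normE in xy.
rewrite -nbhs_ballE => -[e /= e0 eB]; have [y Ay xy] := h e e0.
by exists y; split => //; apply: eB; rewrite -ball_normE.
Qed.

Lemma closed_convex_hull_min E W : convex_set W -> E `<=` W ->
  closed_convex_hull E `<=` closure W.
Proof. by move=> cW EW; apply: closureS; exact: smallest_sub. Qed.

Lemma convex_convex_hull E : convex_set (smallest (@convex_set R X) E).
Proof.
apply/convex_setP => x y t t01 xE yE A cEA; have [/convex_setP cA _] := cEA.
by apply: cA => //; [exact: xE|exact: yE].
Qed.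

Lemma closed_convex_hullS E W : W `<=` E ->
  closed_convex_hull W `<=` closed_convex_hull E.
Proof.
move=> WE; apply: closed_convex_hull_min; first exact: convex_convex_hull.
by move=> x /WE Ex A [_]; exact.
Qed.

Lemma convex_closure A : convex_set A -> convex_set (closure A).
Proof.
move=> /convex_setP cA; apply/convex_setP => x y t /[dup] t01 /andP[t0 t1].
move=> /closureP clx /closureP cly; apply/closureP => e e0.
have e20 : 0 < e / 2 by lra.
have [x' Ax' xx'] := clx _ e20; have [y' Ay' yy'] := cly _ e20.
exists (t *: x' + (1 - t) *: y'); first exact: cA.
have -> : t *: x + (1 - t) *: y - (t *: x' + (1 - t) *: y') =
    t *: (x - x') + (1 - t) *: (y - y') by lmod R [:: x; y; x'; y'].
apply: le_lt_trans (ler_normD _ _) _.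
rewrite !normrZ !ger0_norm ?subr_ge0//.
have : t * `|x - x'| <= t * (e / 2) by rewrite ler_wpM2l// ltW.
have : (1 - t) * `|y - y'| <= (1 - t) * (e / 2).
  by rewrite ler_wpM2l ?subr_ge0// ltW.
lra.
Qed.

Lemma convex_closed_convex_hull E : convex_set (closed_convex_hull E).
Proof. by apply: convex_closure; exact: convex_convex_hull. Qed.

End closed_convex_hull.

(** Puts the use of a linear relation within reach of [lmod]: what remains is an identity valid for
    arbitrary vectors. *)
Lemma eq_subB (V : zmodType) (a b x y : V) : a = b -> x - y = a - b -> x = y.
Proof. by move=> ->; rewrite subrr => /eqP; rewrite subr_eq0 => /eqP. Qed.

Lemma eq_subD (V : zmodType) (a b c d x y : V) :
  a = b -> c = d -> x - y = (a - b) + (c - d) -> x = y.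
Proof.
by move=> -> ->; rewrite !subrr addr0 => /eqP; rewrite subr_eq0 => /eqP.
Qed.

(** * Isometries of unit balls *)

Section mankiewicz.
Context {R : realType} {X : normedModType R} (V : set X).
Hypothesis V0 : V 0.
Hypothesis V_linear : forall (k : R) x y, V x -> V y -> V (k *: x + y).

Local Notation B := (unit_ball V).
Local Notation E := (extreme_points B).

Let VZ (k : R) x : V x -> V (k *: x).
Proof. by move=> Vx; rewrite -[_ *: _]addr0; exact: V_linear. Qed.

Let VD x y : V x -> V y -> V (x + y).
Proof. by move=> Vx Vy; rewrite -(scale1r x); exact: V_linear. Qed.

Let VB x y : V x -> V y -> V (x - y).
Proof. by move=> Vx Vy; rewrite -scaleN1r addrC; exact: V_linear. Qed.

Lemma convex_unit_ball : convex_set B.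
Proof.
apply/convex_setP => x y t /andP[t0 t1] [Vx x1] [Vy y1].
split; first by apply: V_linear => //; exact: VZ.
apply: le_trans (ler_normD _ _) _; rewrite !normrZ !ger0_norm ?subr_ge0//.
have : t * `|x| <= t * 1 by rewrite ler_wpM2l.
have : (1 - t) * `|y| <= (1 - t) * 1 by rewrite ler_wpM2l ?subr_ge0.
lra.
Qed.

Let half01 : 0 < (2^-1 : R) < 1.
Proof. by apply/andP; split; lra. Qed.

(** The vectors [(w - (m - r e)) / r] and [(m + r e - w) / r] lie in the ball and have midpoint [e];
    extremality makes both equal to [e]. *)
Lemma extreme_midpoint e (r : R) w m : E e -> 0 <= r -> V w -> V m ->
  `|w - (m - r *: e)| <= r -> `|w - (m + r *: e)| <= r -> w = m.
Proof.
move=> [[Ve e1] eE]; rewrite le_eqVlt => /predU1P[<- Vw Vm|r0 Vw Vm h1 h2].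
  by rewrite scale0r subr0 normr_le0 subr_eq0 => /eqP.
have r0' : r != 0 by rewrite gt_eqF.
pose y := r^-1 *: (w - (m - r *: e)); pose z := - r^-1 *: (w - (m + r *: e)).
have Ve' : V (r *: e) by exact: VZ.
have By : B y.
  split; first by apply: VZ; do !apply: VB.
  by rewrite normrZ gtr0_norm ?invr_gt0// mulrC ler_pdivrMr// mul1r.
have Bz : B z.
  split; first by apply: VZ; apply: VB => //; exact: VD.
  by rewrite normrZ normrN gtr0_norm ?invr_gt0// mulrC ler_pdivrMr// mul1r.
have [] := eE y z 2^-1 By Bz half01.
  by rewrite /y /z; lmod R [:: e; w; m].
move=> ye _; apply/eqP; rewrite -subr_eq0; apply/eqP.
have -> : w - m = r *: (y - e) by rewrite /y; lmod R [:: e; w; m].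
by rewrite ye subrr scaler0.
Qed.

Let B_add x s t v w : V x -> B v -> B w -> 0 <= s -> 0 <= t ->
  `|x| + s + t <= 1 -> B (x + s *: v + t *: w).
Proof.
move=> Vx [Vv v1] [Vw w1] s0 t0 xst; split.
  by apply: VD; [apply: VD|]; rewrite //; exact: VZ.
apply: le_trans (ler_normD _ _) _.
apply: le_trans (lerD (ler_normD _ _) (lexx _)) _.
rewrite !normrZ !ger0_norm//.
have : s * `|v| <= s * 1 by rewrite ler_wpM2l.
have : t * `|w| <= t * 1 by rewrite ler_wpM2l.
lra.
Qed.

Section isometry.
Context {Y : normedModType R} (L : set Y) (f : X -> Y).
Hypothesis convL : convex_set L.
Hypothesis fB : f @` B = L.
Hypothesis fiso : forall x y, B x -> B y -> `|f x - f y| = `|x - y|.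

Let fL x : B x -> L (f x).
Proof. by move=> Bx; rewrite -fB; exists x. Qed.

Let avgL x y : B x -> B y -> exists2 w, B w & f w = 2^-1 *: (f x + f y).
Proof.
move=> Bx By; suff : L (2^-1 *: (f x + f y)).
  by rewrite -fB => -[w Bw <-]; exists w.
have -> : 2^-1 *: (f x + f y) = 2^-1 *: f x + (1 - 2^-1) *: f y.
  lmod R [:: f x; f y].
move/convex_setP : convL; apply; [|exact: fL|exact: fL].
by apply/andP; split; lra.
Qed.

(** A preimage of the midpoint of the two values has distance at most [r] to [m - r e] and to
    [m + r e], so it is [m]. *)
Lemma isometry_extreme_midpoint e (r : R) m : E e -> 0 <= r ->
  B (m - r *: e) -> B (m + r *: e) ->
  f m = 2^-1 *: (f (m - r *: e) + f (m + r *: e)).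
Proof.
move=> Ee r0 B1 B2; have [w Bw fw] := avgL B1 B2.
have e1 : `|e| <= 1 by case: Ee => -[].
have le_r : 2^-1 * `|(m - r *: e) - (m + r *: e)| <= r.
  have -> : (m - r *: e) - (m + r *: e) = (- (2 * r)) *: e by lmod R [:: m; e].
  rewrite normrZ normrN ger0_norm ?mulr_ge0// !mulrA mulVf// mul1r.
  by rewrite -[leRHS]mulr1 ler_wpM2l.
have Vm : V m.
  have -> : m = 2^-1 *: ((m - r *: e) + (m + r *: e)) by lmod R [:: m; e].
  by apply: VZ; apply: VD; [case: B1|case: B2].
rewrite -fw; congr f; apply/esym; apply: (extreme_midpoint Ee r0) => //.
- by case: Bw.
- rewrite -fiso// fw; set a := f _; set b := f _.
  have -> : 2^-1 *: (a + b) - a = (- 2^-1) *: (a - b) by lmod R [:: a; b].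
  by rewrite normrZ normrN ger0_norm ?invr_ge0// /a /b fiso.
- rewrite -fiso// fw; set a := f _; set b := f (m + _).
  have -> : 2^-1 *: (a + b) - b = 2^-1 *: (a - b) by lmod R [:: a; b].
  by rewrite normrZ ger0_norm ?invr_ge0// /a /b fiso.
Qed.

(* With [P_ij] the images of the corners of the rectangle, [(P_00 + P_11) / 2]
   has the same distances to the images of the midpoints of two opposite sides
   as the image of the center. *)
Lemma isometry_extreme_rectangle e e' (r r' : R) m : E e -> E e' ->
  0 <= r -> 0 <= r' ->
  B (m - r *: e - r' *: e') -> B (m - r *: e + r' *: e') ->
  B (m + r *: e - r' *: e') -> B (m + r *: e + r' *: e') ->
  f (m - r *: e - r' *: e') + f (m + r *: e + r' *: e') =
  f (m - r *: e + r' *: e') + f (m + r *: e - r' *: e').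
Proof.
move=> Ee Ee' r0 r0' B00 B01 B10 B11.
have mid := isometry_extreme_midpoint.
have e1 : `|e| <= 1 by case: Ee => -[].
have Bmid x y : B x -> B y -> B (2^-1 *: x + (1 - 2^-1) *: y).
  by move/convex_setP : convex_unit_ball; apply; apply/andP; split; lra.
have B0 : B (m - r *: e).
  by have := Bmid _ _ B00 B01; congr B; lmod R [:: m; e; e'].
have B1 : B (m + r *: e).
  by have := Bmid _ _ B10 B11; congr B; lmod R [:: m; e; e'].
have f0 := mid e' r' (m - r *: e) Ee' r0' B00 B01.
have f1 := mid e' r' (m + r *: e) Ee' r0' B10 B11.
have [w Bw fw] := avgL B00 B11.
have Vm : V m.
  by have := Bmid _ _ B0 B1; case=> + _; congr V; lmod R [:: m; e].
have distw x y (c : R) : `|c| = 2^-1 -> B x -> B y ->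
    x - y = (2 * r) *: e \/ x - y = - (2 * r) *: e ->
    `|c *: (f x - f y)| <= r.
  move=> c2 Bx By xy; rewrite normrZ c2 fiso//.
  have -> : `|x - y| = 2 * r * `|e|.
    by case: xy => ->; rewrite normrZ ?normrN ger0_norm ?mulr_ge0.
  by rewrite !mulrA mulVf// mul1r -[leRHS]mulr1 ler_wpM2l.
have wm : w = m.
  apply: (extreme_midpoint Ee r0) => //; first by case: Bw.
  - rewrite -fiso// fw f0.
    set a := f (m - r *: e - _); set b := f (m + _ + _); set c := f _.
    have -> : 2^-1 *: (a + b) - 2^-1 *: (a + c) = 2^-1 *: (b - c).
      lmod R [:: a; b; c].
    apply: distw => //; first by rewrite ger0_norm ?invr_ge0.
    by left; lmod R [:: m; e; e'].
  - rewrite -fiso// fw f1.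
    set a := f (m - r *: e - _); set b := f (m + _ + _); set c := f _.
    have -> : 2^-1 *: (a + b) - 2^-1 *: (c + b) = 2^-1 *: (a - c).
      lmod R [:: a; b; c].
    apply: distw => //; first by rewrite ger0_norm ?invr_ge0.
    by right; lmod R [:: m; e; e'].
(* The value at the center is half of [a + b], since [w = m], and a quarter of the sum of all four,
   by the midpoint rule along [e] and [e']. *)
have := mid e r m Ee r0 B0 B1; rewrite -wm fw wm f0 f1.
set a := f (_ - _ - _); set b := f (_ + _ + _).
set c := f (_ - _ + _); set d := f (_ + _ - _) => abcd.
have -> : a + b = 4 *: (2^-1 *: (a + b)) - (a + b) by lmod R [:: a; b].
by rewrite abcd; lmod R [:: a; b; c; d].
Qed.

(** The bound keeps the four points in the ball for any [v] and [w] of [B] and does not mention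
    them, so the relation can pass to convex combinations and limits. *)
Definition additive_increments v w :=
  forall x s t, V x -> 0 <= s -> 0 <= t -> `|x| + s + t <= 1 ->
    f (x + s *: v + t *: w) + f x = f (x + s *: v) + f (x + t *: w).

Lemma additive_incrementsC v w :
  additive_increments v w -> additive_increments w v.
Proof.
move=> vw x s t Vx s0 t0 xst; rewrite [x + _ + _]addrAC [RHS]addrC.
by apply: vw => //; rewrite addrAC.
Qed.

Lemma additive_increments_extreme e e' :
  E e -> E e' -> additive_increments e e'.
Proof.
move=> Ee Ee' x s t Vx s0 t0 xst.
have Be : B e by case: Ee.
have Be' : B e' by case: Ee'.
have Bst s' t' : 0 <= s' <= s -> 0 <= t' <= t -> B (x + s' *: e + t' *: e').
  by move=> /andP[s'0 s's] /andP[t'0 t't]; apply: B_add => //; lra.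
pose m := x + (s / 2) *: e + (t / 2) *: e'.
have E00 : m - (s / 2) *: e - (t / 2) *: e' = x.
  by rewrite /m; lmod R [:: x; e; e'].
have E01 : m - (s / 2) *: e + (t / 2) *: e' = x + t *: e'.
  by rewrite /m; lmod R [:: x; e; e'].
have E10 : m + (s / 2) *: e - (t / 2) *: e' = x + s *: e.
  by rewrite /m; lmod R [:: x; e; e'].
have E11 : m + (s / 2) *: e + (t / 2) *: e' = x + s *: e + t *: e'.
  by rewrite /m; lmod R [:: x; e; e'].
have := @isometry_extreme_rectangle e e' (s / 2) (t / 2) m Ee Ee'.
rewrite E00 E01 E10 E11 => h; rewrite addrC [RHS]addrC; apply: h.
- by rewrite divr_ge0.
- by rewrite divr_ge0.
- have := Bst 0 0; rewrite !scale0r !addr0; apply; apply/andP; split; lra.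
- have := Bst 0 t; rewrite !scale0r !addr0; apply; apply/andP; split; lra.
- have := Bst s 0; rewrite !scale0r !addr0; apply; apply/andP; split; lra.
- by apply: Bst; apply/andP; split; lra.
Qed.

(** The increment along [l v1 + (1 - l) v2] is made in two steps through [y]; the relations for [v1]
    at [x] and for [v2] at [y] add up. *)
Lemma convex_additive_increments w :
  convex_set [set v | B v /\ additive_increments v w].
Proof.
apply/convex_setP => v1 v2 l /[dup] l01 /andP[l0 l1] [Bv1 h1] [Bv2 h2].
split; first by move/convex_setP : convex_unit_ball; exact.
move=> x s t Vx s0 t0 xst; pose y := x + (s * l) *: v1.
have sl0 : 0 <= s * l by rewrite mulr_ge0.
have sl1 : 0 <= s * (1 - l) by rewrite mulr_ge0 ?subr_ge0.
have [Vv1 v11] := Bv1.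
have Vy : V y by apply: VD => //; exact: VZ.
have yst : `|y| + s * (1 - l) + t <= 1.
  have : `|y| <= `|x| + s * l * `|v1|.
    by apply: le_trans (ler_normD _ _) _; rewrite normrZ ger0_norm.
  have : s * l * `|v1| <= s * l * 1 by rewrite ler_wpM2l.
  lra.
have /= := h1 x (s * l) t Vx sl0 t0.
rewrite -/y => /(_ _) H1; have {H1} := H1 ltac:(nra).
have := h2 y (s * (1 - l)) t Vy sl1 t0 yst.
have -> : y + (s * (1 - l)) *: v2 = x + s *: (l *: v1 + (1 - l) *: v2).
  by rewrite /y; lmod R [:: x; v1; v2].
move=> E2 E1; apply: (eq_subD E1 E2).
by lmod R [:: f x; f y; f (x + t *: w); f (y + t *: w);
  f (x + s *: (l *: v1 + (1 - l) *: v2));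
  f (x + s *: (l *: v1 + (1 - l) *: v2) + t *: w)].
Qed.

(** Only two of the four terms contain [v], and [f] moves each by at most [s |v - v'|] when [v']
    replaces [v]. *)
Lemma closed_additive_increments w : B w ->
  B `&` closure [set v | B v /\ additive_increments v w]
    `<=` [set v | B v /\ additive_increments v w].
Proof.
move=> Bw v [Bv /closureP clv]; split => // x s t Vx s0 t0 xst.
apply/eqP; rewrite -subr_eq0 -normr_le0; apply/ler_addgt0Pr => e e0.
have [v' [Bv' h'] vv'] := clv (e / 2) ltac:(lra).
have h := h' x s t Vx s0 t0 xst.
have sdist u u' : u - u' = s *: (v - v') -> `|u - u'| <= e / 2.
  move=> ->; rewrite normrZ ger0_norm//.
  have : s * `|v - v'| <= 1 * `|v - v'|.
    by rewrite ler_wpM2r//; have := normr_ge0 x; lra.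
  by move: vv'; rewrite mul1r => /ltW; move=> /[swap]; exact: le_trans.
have -> : f (x + s *: v + t *: w) + f x - (f (x + s *: v) + f (x + t *: w)) =
    (f (x + s *: v + t *: w) - f (x + s *: v' + t *: w)) +
    (f (x + s *: v') - f (x + s *: v)).
  apply: (eq_subB h).
  by lmod R [:: f x; f (x + s *: v); f (x + t *: w); f (x + s *: v + t *: w);
    f (x + s *: v'); f (x + s *: v' + t *: w)].
rewrite [leRHS]add0r [leRHS]splitr; apply: le_trans (ler_normD _ _) _.
have xs1 : `|x| + s + 0 <= 1 by lra.
have Bsv u : B u -> B (x + s *: u).
  by move=> Bu; have := B_add Vx Bu Bw s0 (lexx 0) xs1; rewrite scale0r addr0.
apply: lerD; first rewrite fiso; try exact: B_add.
  by apply: sdist; lmod R [:: x; v; v'; w].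
rewrite distrC fiso; try exact: Bsv.
by apply: sdist; lmod R [:: x; v; v'].
Qed.

Hypothesis BE : B `<=` closed_convex_hull E.

(** Symmetry lets the passage from [E] to its closed convex hull be made in one argument at a
    time. *)
Lemma additive_increments_unit_ball v w : B v -> B w -> additive_increments v w.
Proof.
have ind u : B u -> (forall e, E e -> additive_increments e u) ->
    forall v, B v -> additive_increments v u.
  move=> Bu Eu z Bz; have [] // : [set v | B v /\ additive_increments v u] z.
  apply: closed_additive_increments => //; split => //.
  apply: (@closed_convex_hull_min _ _ E) (BE Bz).
    exact: convex_additive_increments.
  by move=> e Ee; split; [case: Ee|exact: Eu].
move=> Bv Bw; apply: (ind) => // e Ee; apply: additive_incrementsC.
apply: ind => //; first by case: Ee.
by move=> e' Ee'; exact: additive_increments_extreme.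
Qed.

Lemma isometry_additive x y : V x -> V y -> `|x| + `|y| <= 1 ->
  f (x + y) + f 0 = f x + f y.
Proof.
have unitP z : V z -> B (`|z|^-1 *: z) /\ z = `|z| *: (`|z|^-1 *: z).
  (* For [z = 0] the convention [0^-1 = 0] makes the direction 0. *)
  move=> Vz; have [->|z0] := eqVneq z 0.
    by rewrite !scaler0; split => //; split => //; rewrite normr0.
  rewrite scalerA divff ?normr_eq0// scale1r; split => //.
  by split; [exact: VZ|rewrite normrZ normfV normr_id mulVf ?normr_eq0].
move=> /unitP[Bx xE] /unitP[By yE] xy.
have := @additive_increments_unit_ball _ _ Bx By 0 `|x| `|y| V0.
by rewrite -xE -yE !add0r normr0 add0r; apply.
Qed.

(* The defect [D t] satisfies [D (2 t) = 2 D t] and [D (1 - t) = - D t], so its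
   supremum over [0, 1] is at most half of itself. *)
Lemma isometry_homogeneous x t : B x -> 0 <= t <= 1 ->
  f (t *: x) = t *: f x + (1 - t) *: f 0.
Proof.
move=> [Vx x1] t01; pose D s := f (s *: x) - s *: f x - (1 - s) *: f 0.
have norm_sx s : 0 <= s <= 1 -> `|s *: x| <= s.
  by move=> /andP[s0 s1]; rewrite normrZ ger0_norm// -[leRHS]mulr1 ler_wpM2l.
have B0 : B 0 by split => //; rewrite normr0.
have Dn n s : 0 <= s <= 1 -> `|D s| <= 2 / 2 ^+ n.
  elim: n s => [|n IH] s /[dup] s01 /andP[s0 s1].
    rewrite expr0 divr1.
    have -> : D s = (f (s *: x) - f 0) - s *: (f x - f 0).
      by rewrite /D; lmod R [:: f x; f 0; f (s *: x)].
    apply: le_trans (ler_normB _ _) _.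
    have Bsx : B (s *: x).
      by split; [exact: VZ|apply: le_trans (norm_sx _ s01) _].
    rewrite normrZ (ger0_norm s0) !fiso// !subr0.
    have := norm_sx _ s01.
    have : s * `|x| <= 1 * 1 by rewrite ler_pM.
    lra.
  have half u : 0 <= u <= 2^-1 -> `|D u| <= 2 / 2 ^+ n.+1.
    move=> /andP[u0 u2]; have -> : D u = 2^-1 *: D (2 * u).
      have h : f ((2 * u) *: x) + f 0 = f (u *: x) + f (u *: x).
        have -> : (2 * u) *: x = u *: x + u *: x by lmod R [:: x].
        apply: isometry_additive; [exact: VZ|exact: VZ|].
        have := @norm_sx u ltac:(apply/andP; split; lra); lra.
      apply: (eq_subB (congr1 ( *:%R (- 2^-1)) h)).
      by rewrite /D; lmod R [:: f x; f 0; f (u *: x); f ((2 * u) *: x)].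
    rewrite normrZ ger0_norm ?invr_ge0// exprS invfM mulrCA.
    rewrite ler_wpM2l ?invr_ge0//.
    by apply: IH; apply/andP; split; lra.
  have [s2|s2] := leP s 2^-1; first by apply: half; rewrite s0.
  suff -> : D s = - D (1 - s).
    by rewrite normrN; apply: half; apply/andP; split; lra.
  have h : f x + f 0 = f (s *: x) + f ((1 - s) *: x).
    have {1}-> : x = s *: x + (1 - s) *: x by lmod R [:: x].
    apply: isometry_additive; [exact: VZ|exact: VZ|].
    have := @norm_sx s s01.
    have := @norm_sx (1 - s) ltac:(apply/andP; split; lra); lra.
  apply: (eq_subB (esym h)).
  by rewrite /D; lmod R [:: f x; f 0; f (s *: x); f ((1 - s) *: x)].
suff : D t = 0.
  move=> Dt; apply: (eq_subB Dt).
  by rewrite /D; lmod R [:: f x; f 0; f (t *: x)].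
apply/eqP; rewrite -normr_le0; apply/ler_addgt0Pr => e e0.
(* Any [n >= 2 / e] suffices, because [n <= 2 ^ n]. *)
have := archi_boundP (divr_ge0 (ler0n R 2) (ltW e0)).
set n := Num.bound _ => en; rewrite add0r; apply: le_trans (Dn n _ t01) _.
rewrite ler_pdivrMr ?exprn_gt0// mulrC -ler_pdivrMr//.
apply: le_trans (ltW en) _; rewrite -natrX ler_nat.
by rewrite ltnW// ltn_expl.
Qed.

(** Additivity applies to [t x] and [(1 - t) y]; after homogeneity the multiples of [f 0] cancel. *)
Lemma isometry_affine x y t : B x -> B y -> 0 <= t <= 1 ->
  f (t *: x + (1 - t) *: y) = t *: f x + (1 - t) *: f y.
Proof.
move=> Bx By /[dup] t01 /andP[t0 t1].
have [[Vx x1] [Vy y1]] := (Bx, By).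
have t01' : 0 <= 1 - t <= 1 by apply/andP; split; lra.
have := @isometry_additive (t *: x) ((1 - t) *: y) (VZ _ Vx) (VZ _ Vy).
rewrite !isometry_homogeneous// => h.
have {}h := h ltac:(rewrite !normrZ !ger0_norm ?subr_ge0//; nra).
apply: (eq_subB h).
by lmod R [:: f x; f y; f 0; f (t *: x + (1 - t) *: y)].
Qed.

End isometry.

Lemma strong_mankiewicz_unit_ball :
  B `<=` closed_convex_hull E -> strong_mankiewicz B.
Proof.
move=> BE; split; first exact: convex_unit_ball.
by move=> Y L f cL fB fiso x y t; exact: (isometry_affine cL fB fiso BE).
Qed.

End mankiewicz.

(** * The unit ball of continuous Hilbert-valued functions *)

Section realification.
Context {R : realType}.
Implicit Types (V : normedModType R[i]) (H : hilbertType R).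
Implicit Types (T : topologicalType).

Lemma realification_normE V (v : V) :
  `|(v : realification V)|%:C%C = `|v|.
Proof. by apply: RRe_real; rewrite normr_real. Qed.

Lemma realification_normZ V (c : R[i]) (v : V) :
  `|(c *: v : realification V)| =
  Num.sqrt (complex.Re c ^+ 2 + complex.Im c ^+ 2) * `|(v : realification V)|.
Proof.
apply: complexI; rewrite realification_normE rmorphM/= realification_normE.
by rewrite normrZ normc_def.
Qed.

Lemma realification_continuous V T (f : T -> V) :
  continuous f <-> continuous (f : T -> realification V).
Proof.
have dist (x y : V) : `|(x : realification V) - y|%:C%C = `|x - y|.
  exact: realification_normE.
split=> cf t; apply/cvgrPdist_lt => e e0.
  have e0C : 0 < e%:C%C by rewrite ltcR.
  have /cvgrPdist_lt /(_ _ e0C) := cf t.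
  by apply: filterS => s; rewrite -dist ltcR.
have eE : e = (complex.Re e)%:C%C by rewrite RRe_real ?gtr0_real.
have e0' : 0 < complex.Re e by rewrite -ltcR -eE.
have /cvgrPdist_lt /(_ _ e0') := cf t.
by apply: filterS => s; rewrite -ltcR dist -eE.
Qed.

(** The parallelogram law with weights [t] and [1 - t]; the last term measures the strict convexity
    of [H]. *)
Lemma realification_convex_norm H (x y : realification H) (t : R) :
  `|t *: x + (1 - t) *: y| ^+ 2 =
  t * `|x| ^+ 2 + (1 - t) * `|y| ^+ 2 - t * (1 - t) * `|x - y| ^+ 2.
Proof.
have sqE (v : realification H) : `|v|%:C%C * `|v|%:C%C = inner (v : H) v.
  by rewrite innerE expr2 realification_normE.
apply: complexI; rewrite !(rmorphB, rmorphD, rmorphM, rmorph1)/= !sqE.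
have -> : t *: x + (1 - t) *: y =
  (t%:C%C *: (x : H) + (1 - t%:C%C) *: (y : H)).
  by have -> : 1 - t%:C%C = (1 - t)%:C%C by rewrite rmorphB.
have -> : x - y = (x : H) + (-1) *: (y : H) by rewrite scaleN1r.
rewrite !(innerDl, innerDr, innerZl, innerZr) !(rmorphB, rmorphN, rmorph1)/=.
have -> : (t%:C%C)^*%R = t%:C%C by rewrite conj_Creal// complex_real.
ring.
Qed.

Lemma realification_strictly_convex H (x y : realification H) (t : R) :
  `|x| <= 1 -> `|y| <= 1 -> 0 < t < 1 -> 1 <= `|t *: x + (1 - t) *: y| ->
  x = y.
Proof.
move=> x1 y1 /andP[t0 t1] xy1; apply/eqP; rewrite -subr_eq0 -normr_eq0.
rewrite -sqrf_eq0 eq_le sqr_ge0 andbT.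
have tt : 0 < t * (1 - t) by rewrite mulr_gt0 ?subr_gt0.
rewrite -(pmulr_rle0 _ tt).
have : 1 <= `|t *: x + (1 - t) *: y| ^+ 2 by rewrite expr_ge1.
rewrite realification_convex_norm.
have : t * `|x| ^+ 2 <= t * 1 by rewrite ler_pM2l// expr_le1.
have : (1 - t) * `|y| ^+ 2 <= (1 - t) * 1.
  by rewrite ler_pM2l ?subr_gt0// expr_le1.
lra.
Qed.

End realification.

Section contfun.
Context {R : realType} {K : topologicalType} (cK : compact [set: K]).
Context (H : normedModType R[i]).
Local Notation C := (realification (contfun cK H)).
Local Notation HR := (realification H).

Definition eval (t : K) (a : C) : HR := (a : contfun cK H) t.

Lemma evalD t a b : eval t (a + b) = eval t a + eval t b.
Proof. by []. Qed.

Lemma evalB t a b : eval t (a - b) = eval t a - eval t b.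
Proof. by []. Qed.

Lemma evalZ t (k : R) a : eval t (k *: a) = k *: eval t a.
Proof. by []. Qed.

Lemma eval_inj a b : (forall t, eval t a = eval t b) -> a = b.
Proof. by move=> ab; apply/val_inj/funext. Qed.

Lemma eval_norm t a : `|eval t a| <= `|a|.
Proof. exact: le_supnorm. Qed.

Lemma contfun_norm_le (M : R) a :
  0 <= M -> (forall t, `|eval t a| <= M) -> `|a| <= M.
Proof.
move=> M0 aM; rewrite norm_realification_contfun /supnorm.
(* For empty [K] the supremum is over the empty set and equals 0, whence the condition [0 <= M]. *)
have [->|/set0P A0] :=
    eqVneq [set complex.Re `|(a : contfun cK H) t| | t in [set: K]] set0.
  by rewrite sup0.
by apply: ge_sup => // _ [t _ <-]; exact: aM.
Qed.

Lemma eval_continuous a : continuous (eval ^~ a).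
Proof. by apply/realification_continuous; exact: contfun_continuous. Qed.

Lemma contfun_of_continuous (f : K -> HR) :
  continuous f -> exists a : C, forall t, eval t a = f t.
Proof.
move=> /(@realification_continuous _ H) cf.
have fC : (f : K -> H) \in continuous_pred H by exact/asboolP.
by exists (ContFun cK fC).
Qed.

End contfun.

(** * Russo-Dye decomposition into functions of constant norm 1 *)

Section sphere.
Context {R : realType} {K : topologicalType} (cK : compact [set: K]).
Context (H : normedModType R[i]).
Local Notation C := (realification (contfun cK H)).
Local Notation HR := (realification H).
Implicit Types a u : C.

(** Such [u] play the role of the unitaries in the Russo-Dye theorem; agreement where [|a| = 1]
    keeps [a + u] free of zeros and survives the splitting below. *)
Definition sphere_valued a u :=
  forall t, `|eval t u| = 1 /\ (`|eval t a| = 1 -> eval t u = eval t a).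

(* The midpoint [v] of [a] and [u] has no zero, so [v] is the midpoint of the
   two sphere-valued functions [v +/- sqrt (1 - |v|^2) / |v| * i v]. *)
Lemma sphere_valued_split a u : `|a| <= 1 -> sphere_valued a u ->
  exists u1 u2, [/\ sphere_valued a u1, sphere_valued a u2 & a + u = u1 + u2].
Proof.
move=> a1 ua; pose v t : HR := 2^-1 *: (eval t a + eval t u).
pose iv t : HR := 'i%C *: (v t : H).
(* A zero of [a + u] would be a point with [|a| = 1], hence with [u = a] and [2 u = 0]. *)
have v_gt0 t : 0 < `|v t|.
  rewrite normr_gt0 scaler_eq0 invr_eq0 pnatr_eq0/=; apply/negP => /eqP.
  have [u1 uat] := ua t; move=> au0.
  have auE : eval t a = - eval t u by apply/eqP; rewrite -addr_eq0 au0.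
  have /uat au : `|eval t a| = 1 by rewrite auE normrN.
  have u0 : 2%:R *: eval t u = 0 by rewrite scaler_nat mulr2n {1}au au0.
  move/eqP: u0; rewrite scaler_eq0 pnatr_eq0/= => /eqP u0.
  by move: u1; rewrite u0 normr0 => /eqP; rewrite eq_sym oner_eq0.
have v_le1 t : `|v t| <= 1.
  rewrite normrZ ger0_norm ?invr_ge0//.
  have := ler_normD (eval t a) (eval t u); have := le_trans (eval_norm t a) a1.
  by rewrite (ua t).1; lra.
pose s t := Num.sqrt (1 - `|v t| ^+ 2) / `|v t|.
pose w (e : R) t : HR := v t + (e * s t) *: iv t.
have cv : continuous v.
  move=> t; apply: cvgZl_tmp; apply: cvgD; exact: eval_continuous.
have civ : continuous iv.
  apply/realification_continuous => t; apply: cvgZl_tmp.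
  by move/(@realification_continuous _ H): cv; apply.
have cnv : continuous (fun t => `|v t|) by move=> t; apply: cvg_norm; exact: cv.
have cs : continuous s.
  move=> t; apply: cvgM; last by apply: cvgV; [rewrite gt_eqF|exact: cnv].
  apply: (@continuous_comp _ _ _ (fun t => 1 - `|v t| ^+ 2) Num.sqrt).
    by apply: cvgB; [exact: cvg_cst|apply: cvgM; exact: cnv].
  exact: sqrt_continuous.
have cw e : continuous (w e).
  move=> t; apply: cvgD; first exact: cv.
  by apply: cvgZ; [apply: cvgM; [exact: cvg_cst|exact: cs]|exact: civ].
have sw e (b : C) : e ^+ 2 = 1 -> (forall t, eval t b = w e t) ->
    sphere_valued a b.
  move=> e2 bw t; rewrite bw; split.
    (* The norm of [(1 + i e s) v] is [sqrt (1 + s ^ 2) |v| = 1] by the choice of [s]. *)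
    have -> : w e t = (1 +i* (e * s t))%C *: (v t : H).
      have -> : (1 +i* (e * s t))%C = 1 + (e * s t)%:C%C * 'i%C :> R[i].
        by apply/eqP; rewrite eq_complex/=; apply/andP; split; apply/eqP; ring.
      by rewrite scalerDl scale1r -scalerA.
    rewrite realification_normZ/= exprMn e2 mul1r expr1n /s expr_div_n.
    rewrite sqr_sqrtr ?subr_ge0 ?expr_le1//.
    have r0 := v_gt0 t; rewrite -{3}[`|v t|]ger0_norm// -sqrtr_sqr -sqrtrM.
      by rewrite mulrDl divfK ?expf_neq0 ?gt_eqF// mul1r addrC subrK sqrtr1.
    by rewrite addr_ge0// divr_ge0 ?subr_ge0 ?expr_le1//.
  (* Here [v = a] has norm 1, so [s] vanishes. *)
  move=> at1; have vE : v t = eval t a.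
    by rewrite /v ((ua t).2 at1); lmod R [:: eval t a].
  by rewrite /w /s vE at1 expr1n subrr sqrtr0 mul0r mulr0 scale0r addr0.
have [u1 u1E] := contfun_of_continuous cK (cw 1).
have [u2 u2E] := contfun_of_continuous cK (cw (-1)).
exists u1, u2; split.
- by apply: sw u1E; rewrite expr1n.
- by apply: sw u2E; rewrite sqrrN expr1n.
apply: eval_inj => t; rewrite !evalD u1E u2E /w.
transitivity (2 *: v t); last by lmod R [:: v t; iv t].
by rewrite /v; lmod R [:: eval t a; eval t u].
Qed.

(** Induction by [(n + 1) a + u = (n a + u1) + u2], where [a + u = u1 + u2]. *)
Lemma convex_sphere_valued a (W : set C) : `|a| <= 1 -> convex_set W ->
  sphere_valued a `<=` W -> forall n u, sphere_valued a u ->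
  W ((n%:R / n.+1%:R) *: a + n.+1%:R^-1 *: u).
Proof.
move=> a1 cW aW; elim=> [|n IH] u au.
  by rewrite mul0r scale0r add0r invr1 scale1r; exact: aW.
have [u1 [u2 [au1 au2 auE]]] := sphere_valued_split a1 au.
have n1 : n.+1%:R != 0 :> R by rewrite pnatr_eq0.
have n2 : n.+2%:R != 0 :> R by rewrite pnatr_eq0.
have -> : (n.+1%:R / n.+2%:R) *: a + n.+2%:R^-1 *: u =
    (n.+1%:R / n.+2%:R) *: ((n%:R / n.+1%:R) *: a + n.+1%:R^-1 *: u1) +
    (1 - n.+1%:R / n.+2%:R) *: u2.
  apply: (eq_subB (congr1 ( *:%R (n.+2%:R^-1)) auE)).
  have E1 : n.+1%:R = n%:R + 1 :> R by rewrite natr1.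
  have E2 : n.+2%:R = n%:R + 1 + 1 :> R by rewrite !natr1.
  move: n1 n2; rewrite E2 E1 => n1 n2.
  by lmod R [:: a; u; u1; u2]; apply/andP.
move/convex_setP : cW; apply; [|exact: IH|exact: aW]; apply/andP; split.
  by rewrite divr_ge0.
by rewrite ler_pdivrMr ?ltr0Sn// mul1r ler_nat.
Qed.

(** The combinations [(n a + u) / (n + 1)] have distance [|a - u| / (n + 1)] to [a]; one function
    [u] suffices to start. *)
Lemma closure_sphere_valued a u : `|a| <= 1 -> sphere_valued a u ->
  closed_convex_hull (sphere_valued a) a.
Proof.
move=> a1 au; apply/closureP => e e0.
have := archi_boundP (divr_ge0 (normr_ge0 (a - u)) (ltW e0)).
set n := Num.bound _; rewrite ltr_pdivrMr// => en.
exists ((n%:R / n.+1%:R) *: a + n.+1%:R^-1 *: u).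
  move=> W [cW aW]; exact: convex_sphere_valued.
have n1 : n%:R + 1 != 0 :> R by rewrite natr1 pnatr_eq0.
have -> : a - ((n%:R / n.+1%:R) *: a + n.+1%:R^-1 *: u) =
    n.+1%:R^-1 *: (a - u).
  by rewrite -[n.+1%:R]natr1; lmod R [:: a; u].
rewrite normrZ ger0_norm ?invr_ge0// mulrC ltr_pdivrMr ?ltr0Sn//.
by apply: lt_le_trans en _; rewrite mulrC ler_pM2l// ler_nat.
Qed.

End sphere.

(** * The unit ball of [Nset_real] and its extreme points *)

Section Nset_real_unit_ball.
Context {R : realType} {K : topologicalType} (cK : compact [set: K]).
Context (H : hilbertType R).
Local Notation C := (realification (contfun cK H)).
Local Notation HR := (realification H).
Context (x0 : H) (O : set K) (t0 : K) (x01 : `|x0| = 1) (Ot0 : O t0).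
Local Notation N := (Nset_real x0 O t0 : set C).
Local Notation B := (unit_ball N).
Implicit Types a b u : C.

Let x01R : `|(x0 : HR)| = 1.
Proof. by apply: complexI; rewrite realification_normE x01 rmorph1. Qed.

Lemma Nset_realP a :
  N a <-> exists m : R, forall t, O t -> eval t a = m *: (x0 : HR).
Proof.
split=> [[Na /complex_realP[m phiE]]|[m am]].
  by exists m => t Ot; rewrite [LHS](Nset_phiE x01 Ot0 Na Ot) phiE.
split; first by apply/NsetP; exists m%:C%C.
by rewrite (@phiE _ _ cK _ _ _ _ x01 Ot0 a m%:C%C am) complex_real.
Qed.

Lemma Nset_real0 : N 0.
Proof. by apply/Nset_realP; exists 0 => t _; rewrite scale0r. Qed.

Lemma Nset_real_linear (k : R) a b : N a -> N b -> N (k *: a + b).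
Proof.
move=> /Nset_realP[m am] /Nset_realP[n bn]; apply/Nset_realP.
exists (k * m + n) => t Ot; rewrite evalD evalZ am// bn//.
by lmod R [:: x0 : HR].
Qed.

(** The multiples of [x0] on [O] vary by at most the distance of the functions, as [x0] has norm 1;
    the limit has the multiple read off at [t0]. *)
Lemma closed_Nset_real_unit_ball : closure B `<=` B.
Proof.
move=> a /closureP cla; split; last first.
  apply/ler_addgt0Pr => e e0; have [b [_ b1] ab] := cla e e0.
  have := ler_normD (a - b) b; rewrite subrK; lra.
apply/Nset_realP; exists (complex.Re (inner (eval t0 a : H) x0)) => t Ot.
set m := complex.Re _.
apply/eqP; rewrite -subr_eq0 -normr_le0; apply/ler_addgt0Pr => e e0.
have [b [/Nset_realP[n bn] _] ab] := cla (e / 2) ltac:(lra).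
rewrite add0r.
have -> : eval t a - m *: (x0 : HR) =
    eval t (a - b) + (n - m) *: (x0 : HR).
  by rewrite evalB (bn t Ot); lmod R [:: eval t a; x0 : HR].
apply: le_trans (ler_normD _ _) _; rewrite normrZ x01R mulr1.
have nm : `|n - m| <= `|eval t0 (a - b)|.
  have -> : n - m = - complex.Re (inner (eval t0 (a - b) : H) x0).
    have -> : inner (eval t0 (a - b) : H) x0 =
        inner (eval t0 a : H) x0 - n%:C%C.
      have -> : eval t0 (a - b) = (eval t0 a : H) + (- n%:C%C) *: x0.
        by rewrite evalB (bn t0 Ot0) scaleNr.
      by rewrite innerDl innerZl innerE x01 expr1n mulr1.
    by rewrite raddfB/= -/m opprB.
  rewrite normrN -lecR (le_trans (normc_ge_Re _))//.
  by rewrite (le_trans (normr_inner _ _))// x01 mulr1 realification_normE.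
have := eval_norm t0 (a - b); have := eval_norm t (a - b).
lra.
Qed.

(** At each point a unit vector is split into two vectors of the unit ball, which strict convexity
    makes equal. *)
Lemma sphere_valued_extreme u :
  N u -> (forall t, `|eval t u| = 1) -> extreme_points B u.
Proof.
move=> Nu u1; split.
  by split => //; apply: contfun_norm_le => // t; rewrite u1.
move=> y z t [_ y1] [_ z1] t01 uE.
suff yz : y = z by rewrite uE yz -scalerDl addrC subrK scale1r.
apply: eval_inj => s; apply: (realification_strictly_convex _ _ t01).
- exact: le_trans (eval_norm _ _) y1.
- exact: le_trans (eval_norm _ _) z1.
- by rewrite -!evalZ -evalD -uE u1.
Qed.

Let hull := closed_convex_hull (extreme_points B).

(** Mixing in a little of the constant function [s x0] leaves norm 1 only at points where [b]
    already equals [s x0], so this constant agrees with the mixture there. *)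
Lemma hull_of_constant (s : R) b : `|s| = 1 -> `|b| <= 1 ->
  (forall t, O t -> eval t b = s *: (x0 : HR)) -> hull b.
Proof.
move=> s1 b1 bO; pose e0 : HR := s *: (x0 : HR).
have e01 : `|e0| = 1 by rewrite normrZ s1 mul1r x01R.
have [e eE] : exists e : C, forall t, eval t e = e0.
  by apply: contfun_of_continuous => t; exact: cvg_cst.
have e1 : `|e| <= 1 by apply: contfun_norm_le => // t; rewrite eE e01.
apply: closed_closure; apply/closureP => d d0.
(* As [|b - e| <= 2], the mixture is within [d / 2] of [b]; [c < 1] is for strict convexity. *)
pose c := Num.min (d / 4) 2^-1.
have c0 : 0 < c by rewrite lt_min; apply/andP; split; lra.
have cd : c <= d / 4 by rewrite ge_min lexx.
have c2 : c <= 2^-1 by rewrite ge_min lexx orbT.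
have c01 : 0 <= c <= 1 by apply/andP; split; lra.
exists (c *: e + (1 - c) *: b); last first.
  have -> : b - (c *: e + (1 - c) *: b) = c *: (b - e) by lmod R [:: b; e].
  rewrite normrZ gtr0_norm//; have := ler_normB b e.
  by nra.
set a := _ + _.
have a1 : `|a| <= 1.
  apply: le_trans (ler_normD _ _) _; rewrite !normrZ !ger0_norm; nra.
have aO t : O t -> eval t a = e0.
  by move=> Ot; rewrite /a evalD !evalZ eE bO// /e0; lmod R [:: x0 : HR].
have ae : sphere_valued a e.
  move=> t; rewrite eE; split => // at1; rewrite /a evalD !evalZ eE.
  suff <- : e0 = eval t b by lmod R [:: e0].
  apply: (@realification_strictly_convex _ _ _ _ c).
  - by rewrite e01.
  - exact: le_trans (eval_norm _ _) b1.
  - by apply/andP; split; lra.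
  - by rewrite -[leLHS]at1 /a evalD !evalZ eE.
(* A function that is sphere-valued for [a] equals [s x0] on [O], so it lies in [N] and is
   extreme. *)
apply: closed_convex_hullS (closure_sphere_valued a1 ae) => u au.
apply: sphere_valued_extreme => [|t]; last by have [] := au t.
apply/Nset_realP; exists s => t Ot; have [_ ->] := au t; first exact: aO.
by rewrite aO.
Qed.

(* For [|m| < 1], the functions [a + k (+/- 1 - m) x0] with
   [k = max (0, 1 - |a - m x0| / (1 - |m|))] stay in the unit ball, are constant
   [+/- x0] on [O], and have [a] as a convex combination. *)
Lemma unit_ball_sub_hull : B `<=` hull.
Proof.
move=> a [/Nset_realP[m am] a1].
have m1 : `|m| <= 1.
  have : `|eval t0 a| <= 1 := le_trans (eval_norm _ _) a1.
  by rewrite am// normrZ x01R mulr1.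
(* For [|m| = 1] there is no dividing by [1 - |m|], but [a] is already a constant of norm 1 on
   [O]. *)
have [m1'|m1'] := leP 1 `|m|.
  by apply: (@hull_of_constant m) => //; apply/eqP; rewrite eq_le m1 m1'.
pose d t := `|eval t a - m *: (x0 : HR)|.
pose k t := Num.max 0 (1 - d t / (1 - `|m|)).
have cd : continuous d.
  move=> t; apply: cvg_norm.
  by apply: cvgB; [exact: eval_continuous|exact: cvg_cst].
have ck : continuous k.
  move=> t; apply: (@continuous_max R K (fun=> 0)
    (fun t => 1 - d t / (1 - `|m|))); first exact: cvg_cst.
  apply: cvgB; first exact: cvg_cst.
  by apply: cvgM; [exact: cd|exact: cvg_cst].
have H0 : 0 < 1 - `|m| by rewrite subr_gt0.
have exb (s : R) : `|s| = 1 ->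
    exists2 b : C, hull b &
      forall t, eval t b = eval t a + (k t * (s - m)) *: (x0 : HR).
  move=> s1; pose g t := eval t a + (k t * (s - m)) *: (x0 : HR).
  have [|b bE] := @contfun_of_continuous R K cK H g.
    move=> t; apply: cvgD; first exact: eval_continuous.
    apply: cvgZ; last exact: cvg_cst.
    by apply: cvgM; [exact: ck|exact: cvg_cst].
  exists b => //; apply: (@hull_of_constant s) => //.
    apply: contfun_norm_le => // t; rewrite bE /g.
    have dE : d t = d t / (1 - `|m|) * (1 - `|m|) by rewrite divfK ?gt_eqF.
    rewrite /k; case: (leP 0 (1 - _)) => [k0|k0]; last first.
      by rewrite mul0r scale0r addr0 (le_trans (eval_norm _ _)).
    move: k0 dE; set q := d t / _ => q1 dE.
    have q0 : 0 <= q by apply: divr_ge0; [exact: normr_ge0|exact: ltW].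
    clearbody q.
    (* Here [|a - m x0| = q (1 - |m|)], so the norm is at most [q (1 - |m|) + q |m| + 1 - q = 1]. *)
    have -> : eval t a + ((1 - q) * (s - m)) *: (x0 : HR) =
        (eval t a - m *: (x0 : HR)) + (q * m + (1 - q) * s) *: (x0 : HR).
      by lmod R [:: eval t a; x0 : HR].
    apply: le_trans (ler_normD _ _) _; rewrite normrZ x01R mulr1 -/(d t) dE.
    have : `|q * m + (1 - q) * s| <= q * `|m| + (1 - q).
      apply: le_trans (ler_normD _ _) _; rewrite !normrM s1 mulr1.
      by rewrite (ger0_norm q0) (ger0_norm q1).
    lra.
  move=> t Ot; rewrite bE /g am// /k /d am// subrr normr0 mul0r subr0.
  rewrite max_r ?ler01// mul1r.
  by lmod R [:: x0 : HR].
have [b1 Hb1 b1E] := exb 1 ltac:(by rewrite normr1).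
have [b2 Hb2 b2E] := exb (-1) ltac:(by rewrite normrN1).
(* These weights average [1] and [-1] to [m], so the corrections [k (s - m) x0] cancel. *)
have -> : a = ((1 + m) / 2) *: b1 + (1 - (1 + m) / 2) *: b2.
  apply: eval_inj => t; rewrite evalD !evalZ b1E b2E.
  by lmod R [:: eval t a; x0 : HR].
move/convex_setP : (@convex_closed_convex_hull _ _ (extreme_points B)).
apply => //.
by move: m1; rewrite ler_norml => /andP[? ?]; apply/andP; split; lra.
Qed.

End Nset_real_unit_ball.

Theorem proposition4p9 (R : realType) (K : topologicalType)
  (cK : compact [set: K]) (hK : hausdorff_space K) (H : hilbertType R)
  (x0 : H) (hx0 : `|x0| = 1) (O : set K) (oO : open O) (O0 : O !=set0)
  (t0 : K) (Ot0 : O t0) :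
  let B : set (realification (contfun cK H)) :=
    unit_ball (Nset_real x0 O t0) in
  B = closed_convex_hull (extreme_points B) /\ strong_mankiewicz B.
Proof.
move=> B.
have N0 := Nset_real0 cK hx0 Ot0.
have NL := @Nset_real_linear R K cK H x0 O t0 hx0 Ot0.
have BE : B `<=` closed_convex_hull (extreme_points B).
  exact: unit_ball_sub_hull.
split; last exact: (strong_mankiewicz_unit_ball N0 NL BE).
(* The ball is closed, convex and contains its extreme points. *)
apply/seteqP; split => // a Ea; apply: (closed_Nset_real_unit_ball hx0 Ot0).
apply: closed_convex_hull_min Ea; last by move=> e [].
exact: convex_unit_ball NL.
Qed.
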